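(* Let $G$ be a finite simple graph with $\alpha(G) \le 2$. If $G$ is $W_5$-free, then $h(G) \ge \chi(G)$.
   Context: For a graph $G$, $\alpha(G)$ denotes the independence number (maximum size of a set of pairwise non-adjacent vertices) and $\chi(G)$ the chromatic number. The Hadwiger number $h(G)$ is the largest integer $t$ such that $G$ contains the complete graph $K_t$ as a minor (i.e., $K_t$ can be obtained from a subgraph of $G$ by contracting edges). $W_5$ denotes the wheel on six vertices, i.e., the graph obtained from a 5-cycle $C_5$ by adding one vertex adjacent to all five cycle vertices. A graph $G$ is $W_5$-free if it contains no induced subgraph isomorphic to $W_5$. *)

(* Defs.v *)
From mathcomp Require Import all_boot.
Set Implicit Arguments. Unset Strict Implicit. Unset Printing Implicit Defensive.

Section Graphs.
Variables (T : finType) (e : rel T).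

Definition simple_graph : Prop := symmetric e /\ irreflexive e.

Definition stable (S : {set T}) : bool :=
  [forall x in S, forall y in S, ~~ e x y].
Definition alpha : nat := \max_(S : {set T} | stable S) #|S|.

Definition colorable (k : nat) : bool :=
  [exists f : {ffun T -> 'I_k},
     [forall x, forall y, ((x != y) && e x y) ==> (f x != f y)]].

Lemma colorable_card : exists k, colorable k.
Proof.
exists #|T|; apply/existsP; exists [ffun x => enum_rank x].
apply/forallP => x; apply/forallP => y; apply/implyP => /andP [nxy _].
by rewrite !ffunE; apply: contra nxy => /eqP /enum_rank_inj ->.
Qed.

Definition chi : nat := ex_minn colorable_card.

Definition induced_rel (S : {set T}) : rel T :=
  [rel u v | [&& u \in S, v \in S & e u v]].
Definition connected_in (S : {set T}) : bool :=
  [forall x in S, forall y in S, connect (induced_rel S) x y].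

Definition has_K_minor (t : nat) : bool :=
  [exists B : {ffun 'I_t -> {set T}},
    [&& [forall i, B i != set0],
        [forall i, connected_in (B i)],
        [forall i, forall j, (i != j) ==> [disjoint B i & B j]] &
        [forall i, forall j, (i != j) ==>
           [exists x in B i, exists y in B j, e x y]]]].

(* Hadwiger number: largest t with K_t a minor (t <= #|T| necessarily). *)
Definition hadwiger : nat := \max_(t < #|T|.+1 | has_K_minor t) t.

(* The wheel W_5 on 'I_6: 0..4 form the 5-cycle, 5 is the hub. *)
Definition w5_rel : rel 'I_6 := fun i j =>
  (i != j) &&
  [|| (i == 5 :> nat), (j == 5 :> nat),
      ((i.+1 %% 5) == j :> nat) | ((j.+1 %% 5) == i :> nat)].

Definition has_induced_W5 : Prop :=
  exists w : 'I_6 -> T, injective w /\ forall i j, e (w i) (w j) = w5_rel i j.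

Definition W5_free : Prop := ~ has_induced_W5.

End Graphs.

(* Main.v *)
Require Import Defs.
From mathcomp Require Import all_boot zify.

(** Let [H] be the complement of [G]: it is triangle-free, and [W_5]-freeness says
that every 5-cycle of [H] dominates [H].

First, [G] has a clique minor of order at least [n/2].  If an edge of [G] dominates
[G], it is taken as a branch set and the rest is done by induction; so assume that
non-adjacent vertices of [H] have a common neighbour.  Without 5-cycles, [H] is then
bipartite and [G] has a clique on [n/2] vertices.  Otherwise choose a 5-cycle
[c0 .. c4] of [H] that lexicographically minimises [|B1|] and [|B2|], where [B1] is
the set of common neighbours of [c0], [c2] and [B2] that of [c1], [c3].  Minimality
forces the pairs of [B2 * X] and of [B1 * W], for suitable [X] and [W] with
[|X| >= |B2|] and [|W| >= |B1|], to have common neighbourhoods [B1] and [B2]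
respectively.  Matching [B2] into [X] and [B1] into [W] yields pairwise adjacent
branch sets of size two that dominate everything else, and induction applies.

Second, [n/2] is replaced by [n - m], where [m] is the matching number of [H] (so that
[n - m] colours suffice for [G]).  A vertex covered by all maximum matchings can be
removed.  If there is none, then by Gallai's argument being missed by no common maximum
matching is an equivalence relation containing adjacency in [H]; with several classes
[G] is a join, and with a single class [m >= (n - 1)/2]. *)

Set Implicit Arguments. Unset Strict Implicit. Unset Printing Implicit Defensive.

(** * Triangle-free graphs of diameter two in which every 5-cycle dominates *)

Section DominatingPentagons.
Variables (T : finType) (h : rel T) (V : {set T}).

Definition pentagon (c0 c1 c2 c3 c4 : T) : bool :=
  [&& h c0 c1, h c1 c2, h c2 c3, h c3 c4 & h c4 c0].

Definition common (x y : T) : {set T} := [set z | h x z && h y z].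

Hypothesis h_sym : symmetric h.
Hypothesis h_supp : forall x y, h x y -> x \in V.
Hypothesis triangle_free : forall x y z, h x y -> h y z -> h x z -> False.
Hypothesis pentagon_dom : forall c0 c1 c2 c3 c4 v,
  pentagon c0 c1 c2 c3 c4 -> v \in V ->
  [|| h v c0, h v c1, h v c2, h v c3 | h v c4].
Hypothesis diam2 : forall x y, x \in V -> y \in V -> x != y -> ~~ h x y ->
  exists2 z, h x z & h y z.

Lemma commonC x y : common x y = common y x.
Proof. by apply/setP=> z; rewrite !inE andbC. Qed.

Let flip x y : h x y -> h y x. Proof. by rewrite h_sym. Qed.

Ltac symmetrize :=
  repeat match goal with
  | H : is_true (h ?a ?b) |- _ =>
      lazymatch goal with
      | _ : is_true (h b a) |- _ => fail
      | _ => have := flip H; intro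
      end
  end.

Ltac triangle :=
  exfalso; symmetrize;
  first
  [ match goal with
    | H : is_true (h ?a ?b), K : is_true (~~ h ?a ?b) |- _ =>
        exact: (negP K H)
    | H : is_true (h ?a ?b), K : is_true (~~ h ?b ?a) |- _ =>
        exact: (negP K (flip H))
    end
  | match goal with
    | H1 : is_true (h ?a ?b), H2 : is_true (h ?b ?c), H3 : is_true (h ?a ?c)
      |- _ => exact: (triangle_free H1 H2 H3)
    end ].

Ltac dominate P v :=
  let vV := fresh "vV" in
  have vV : v \in V; [by symmetrize; eapply h_supp; eassumption | ];
  case/orP: (pentagon_dom P vV) => [|/or4P[]]; try (move=> *; triangle).

Lemma nonadj_common x y z : h x z -> h y z -> ~~ h x y.
Proof. by move=> xz yz; apply/negP => xy; triangle. Qed.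

(* [N(b) :&: N(c0)] and [N(b') :&: N(c0)] are nested: otherwise [p], [q] and [c4], common
   neighbours of the antipodal pairs of the 6-cycle [c0 v b c3 b' v'], form a triangle. *)
Lemma common_comparable c0 c1 c3 c4 b b' v v' :
    h c0 c1 -> h c3 c4 -> h c4 c0 -> h c1 b -> h c3 b -> h c1 b' -> h c3 b' ->
    h c0 v -> h b v -> ~~ h b' v -> h c0 v' -> h b' v' -> ~~ h b v' -> False.
Proof.
move=> h01 h34 h40 h1b h3b h1b' h3b' h0v hbv nb'v h0v' hb'v' nbv'.
have [p hvp hb'p] : exists2 p, h v p & h b' p.
  apply: diam2; [exact: h_supp (flip h0v)|exact: h_supp hb'v'| |].
    by apply/eqP => E; subst v; triangle.
  by rewrite h_sym.
have [q hbq hv'q] : exists2 q, h b q & h v' q.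
  apply: diam2; [exact: h_supp hbv|exact: h_supp (flip h0v')| |] => //.
  by apply/eqP => E; subst v'; triangle.
have hqp : h q p.
  have P : pentagon v p b' c1 c0 by apply/and5P; split=> //; apply: flip.
  by dominate P q.
have hc4p : h c4 p.
  have P : pentagon v b c1 b' p by apply/and5P; split=> //; apply: flip.
  by dominate P c4.
have hc4q : h c4 q.
  have P : pentagon v' b' c1 b q by apply/and5P; split=> //; apply: flip.
  by dominate P c4.
by triangle.
Qed.

(** A common neighbour [w] of [c2] and [v] can replace [c3]: the 5-cycle [c1 c2 w v b] dominates
    [c4], and any neighbour of [c4] on it other than [w] closes a triangle. The change loses [b], as
    [w v b] is no triangle, and gains nothing by [common_comparable]. *)
Lemma pentagon_shrink c0 c1 c2 c3 c4 b v :
    pentagon c0 c1 c2 c3 c4 -> b \in common c1 c3 -> v \in common c0 b ->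
    ~~ h c2 v ->
  exists w, pentagon c0 c1 c2 w c4 /\ common c1 w \proper common c1 c3.
Proof.
move=> /and5P[h01 h12 h23 h34 h40] /[!inE] /andP[h1b h3b] /andP[h0v hbv] n2v.
have [w h2w hvw] : exists2 w, h c2 w & h v w.
  apply: diam2; [exact: h_supp h23|exact: h_supp (flip h0v)| |] => //.
  by apply/eqP => E; subst v; triangle.
have hw4 : h w c4.
  have P : pentagon c1 c2 w v b by apply/and5P; split=> //; apply: flip.
  by dominate P c4; apply: flip.
exists w; split; first exact/and5P.
have nbw : ~~ h w b by apply/negP => hwb; triangle.
apply/properP; split; last by exists b; rewrite !inE ?h1b ?h3b // negb_and nbw orbT.
apply/subsetP => u /[!inE] /andP[h1u hwu]; rewrite h1u /=.
apply/negPn/negP => n3u.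
apply: (@common_comparable c1 c2 c4 c0 c3 w b u) => //; exact: flip.
Qed.

Lemma pentagon_rot c0 c1 c2 c3 c4 :
  pentagon c0 c1 c2 c3 c4 -> pentagon c1 c2 c3 c4 c0.
Proof. by case/and5P=> *; apply/and5P. Qed.

Lemma pentagon_rev c0 c1 c2 c3 c4 :
  pentagon c0 c1 c2 c3 c4 -> pentagon c4 c3 c2 c1 c0.
Proof. by case/and5P=> *; apply/and5P; split; apply: flip. Qed.

Section LexMin.
Variables m r : nat.
Hypothesis m_min : forall c0 c1 c2 c3 c4, pentagon c0 c1 c2 c3 c4 ->
  m <= #|common c0 c2|.
Hypothesis r_min : forall c0 c1 c2 c3 c4, pentagon c0 c1 c2 c3 c4 ->
  #|common c0 c2| = m -> r <= #|common c1 c3|.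

(** An element of [common c0 b] outside [common c0 c2] would let [pentagon_shrink] reduce
    [common c1 c3] with [c0] and [c2] kept, against [r_min]. The inclusion is an equality because
    [m_min] applies to the 5-cycle [c0 c1 b c3 c4]. *)
Lemma lexmin_left c0 c1 c2 c3 c4 b :
    pentagon c0 c1 c2 c3 c4 -> #|common c0 c2| = m -> #|common c1 c3| = r ->
    b \in common c1 c3 -> common c0 b = common c0 c2.
Proof.
move=> P Em Er bB; apply/eqP; rewrite eqEcard; apply/andP; split.
  apply/subsetP => v vC; move: (vC); rewrite !inE => /andP[-> _] /=.
  apply/negPn/negP => n2v.
  have [w [Pw /proper_card]] := pentagon_shrink P bB vC n2v.
  by rewrite Er ltnNge (r_min Pw Em).
rewrite Em; apply: (@m_min _ c1 _ c3 c4).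
by case/and5P: P => *; move: bB; rewrite inE => /andP[]*; apply/and5P; split=> //; apply: flip.
Qed.

(** Shrinking along the reversed cycle would reduce [common c0 c2] itself, against [m_min]; the
    converse inclusion is read off from [lexmin_left]. *)
Lemma lexmin_right c0 c1 c2 c3 c4 z :
    pentagon c0 c1 c2 c3 c4 -> #|common c0 c2| = m -> #|common c1 c3| = r ->
    z \in common c0 c2 -> common z c3 = common c1 c3.
Proof.
move=> P Em Er zB; apply/eqP; rewrite eqEsubset; apply/andP; split; apply/subsetP => y.
  move=> yC; move: (yC); rewrite !inE => /andP[_ ->]; rewrite andbT.
  apply/negPn/negP => n1y.
  have Q : pentagon c3 c2 c1 c0 c4 by apply: pentagon_rot; apply: pentagon_rev.
  rewrite commonC in zB; rewrite commonC in yC.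
  have [w [Pw /proper_card]] := pentagon_shrink Q zB yC n1y.
  rewrite [in X in _ < X]commonC Em ltnNge commonC.
  by rewrite (m_min (pentagon_rot (pentagon_rev Pw))).
move=> yC; move: (zB); rewrite -(lexmin_left P Em Er yC).
by move: yC; rewrite !inE => /andP[_ ->] /andP[_]; rewrite h_sym => ->.
Qed.

End LexMin.

(* The 5-cycle minimises [#|B1|], then [#|B2|]; with [c0 .. c3] fixed, the last vertex is
   chosen twice: [c4] minimises [#|W|] and [t] minimises [#|X|].  That [#|B2| <= #|X|]
   comes from reversing the cycle. *)
Lemma lexmin_pentagon d0 d1 d2 d3 d4 : pentagon d0 d1 d2 d3 d4 ->
  exists B1 B2 X W : {set T}, exists c0 c1 c2 c3 c4 t : T,
  [/\ pentagon c0 c1 c2 c3 c4, pentagon c0 c1 c2 c3 t,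
      [/\ B1 = common c0 c2, B2 = common c1 c3, X = common c1 t & W = common c2 c4],
      #|B2| <= #|X| /\ #|B1| <= #|W| &
      (forall x b, x \in X -> b \in B2 -> common x b = B1) /\
      (forall z w, z \in B1 -> w \in W -> common z w = B2)].
Proof.
move=> D.
pose P (c : T * T * T * T * T) := let: (c0, c1, c2, c3, c4) := c in pentagon c0 c1 c2 c3 c4.
pose f (c : T * T * T * T * T) := let: (c0, c1, c2, c3, c4) := c in #|common c0 c2|.
pose g (c : T * T * T * T * T) := let: (c0, c1, c2, c3, c4) := c in #|common c1 c3|.
have [c' Pc' fmin] := @arg_minnP _ (d0,d1,d2,d3,d4) P f D.
have Qc' : P c' && (f c' == f c') by rewrite Pc' eqxx.
have [[[[[c0 c1] c2] c3] s] /andP[/= Pc /eqP Em] gmin] :=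
  @arg_minnP _ c' [pred c | P c && (f c == f c')] g Qc'.
move: (f c') fmin Em gmin => m fmin Em gmin {c' Pc' Qc'}.
have m_min e0 e1 e2 e3 e4 : pentagon e0 e1 e2 e3 e4 -> m <= #|common e0 e2|.
  by move=> E; apply: (fmin (e0,e1,e2,e3,e4)).
pose r := #|common c1 c3|.
have r_min e0 e1 e2 e3 e4 : pentagon e0 e1 e2 e3 e4 ->
    #|common e0 e2| = m -> r <= #|common e1 e3|.
  by move=> E Ee; apply: (gmin (e0,e1,e2,e3,e4)); rewrite /= E Ee eqxx.
have [c4 P4 c4min] := @arg_minnP _ s (pentagon c0 c1 c2 c3) (fun x => #|common c2 x|) Pc.
have [t Pt tmin] := @arg_minnP _ s (pentagon c0 c1 c2 c3) (fun x => #|common c1 x|) Pc.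
exists (common c0 c2), (common c1 c3), (common c1 t), (common c2 c4).
exists c0, c1, c2, c3, c4, t; split=> //; first split.
(* The reversed cycle has the same first common neighbourhood [B1], and its second one is [X]. *)
- apply: (@r_min c2 c1 c0 t c3); last by rewrite commonC.
  by do 2!apply: pentagon_rot; apply: pentagon_rev.
- by rewrite Em; apply: (@m_min c2 c3 c4 c0 c1); do 2!apply: pentagon_rot.
split=> [x b xX bB|z w zB wW].
- have Px : pentagon x c1 c2 c3 t.
    case/and5P: Pt => *; move: xX; rewrite inE => /andP[]*.
    by apply/and5P; split=> //; apply: flip.
  (* Otherwise [pentagon_shrink] replaces [t] by a vertex sharing fewer neighbours with [c1],
     against the choice of [t]. *)
  have Ex : common x c2 = common c0 c2.
    apply/eqP; rewrite eqEcard; apply/andP; split; last first.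
      by rewrite Em (m_min _ _ _ _ _ Px).
    apply/subsetP => v vC; move: (vC); rewrite !inE => /andP[_ ->]; rewrite andbT.
    apply/negPn/negP => n0v; rewrite commonC in vC.
    have Q : pentagon c2 c1 c0 t c3 by do 2!apply: pentagon_rot; apply: pentagon_rev.
    have [w [Pw /proper_card]] := pentagon_shrink Q xX vC n0v.
    rewrite ltnNge tmin //.
    by do 2!apply: pentagon_rot; apply: pentagon_rev.
  by rewrite -Ex; apply: (lexmin_left m_min r_min Px) => //; rewrite Ex.
- have Pw : pentagon c0 c1 c2 w c4.
    case/and5P: P4 => *; move: wW; rewrite inE => /andP[]*.
    by apply/and5P; split=> //; apply: flip.
  (* Here it is the choice of [c4] that excludes shrinking. *)
  have Ew : common c1 w = common c1 c3.
    apply/eqP; rewrite eqEcard; apply/andP; split; last exact: (r_min _ _ _ _ _ Pw).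
    apply/subsetP => v vC; move: (vC); rewrite !inE => /andP[-> _] /=.
    apply/negPn/negP => n3v.
    have [u [Pu /proper_card]] := pentagon_shrink (pentagon_rot P4) wW vC n3v.
    rewrite ltnNge c4min //.
    by do 4!apply: pentagon_rot.
  by rewrite -Ew; apply: (lexmin_right m_min r_min Pw) => //; rewrite Ew.
Qed.

(** [B2 :|: X] lies in the neighbourhood of [c1] and [B1 :|: W] in that of [c2], so both are stable,
    and they are disjoint because [c1 c2] is an edge. The edges [c3 t] and [c4 c0] separate [B2]
    from [X] and [B1] from [W]. An edge [x w] would put [w] in [common x c2], which is [B1], and
    create the triangle [w c0 c4]. *)
Lemma dominating_classes d0 d1 d2 d3 d4 : pentagon d0 d1 d2 d3 d4 ->
  exists B1 B2 X W : {set T},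
  [/\ B1 :|: B2 :|: X :|: W \subset V, B2 != set0, #|B2| <= #|X| /\ #|B1| <= #|W|,
      [/\ [disjoint B2 & X], [disjoint B1 & W] & [disjoint B2 :|: X & B1 :|: W]] &
      [/\ {in B2 :|: X &, forall x y, ~~ h x y}, {in B1 :|: W &, forall x y, ~~ h x y},
          (forall x w, x \in X -> w \in W -> ~~ h x w),
          (forall x b, x \in X -> b \in B2 -> common x b = B1) &
          (forall z w, z \in B1 -> w \in W -> common z w = B2)]].
Proof.
move=> /lexmin_pentagon[B1 [B2 [X [W [c0 [c1 [c2 [c3 [c4 [t]]]]]]]]]].
case=> P4 Pt [E1 E2 EX EW] leX [XB WB].
have /and5P[h01 h12 h23 h34 h40] := P4.
have /and5P[_ _ _ h3t ht0] := Pt.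
have c2B : c2 \in B2 by rewrite E2 inE h12 flip.
have N1 x : x \in B2 :|: X -> h c1 x.
  by rewrite E2 EX !inE => /orP[]/andP[].
have N2 x : x \in B1 :|: W -> h c2 x.
  by rewrite E1 EW !inE => /orP[]/andP[].
exists B1, B2, X, W; split=> //; [|by apply/set0Pn; exists c2|split|split=> //].
- apply/subsetP => x; rewrite -!setUA setUCA setUA (setUC B2) -setUA => xU.
  have : (x \in B2 :|: X) || (x \in B1 :|: W).
    by move: xU; rewrite !inE; do 4!case: (x \in _).
  by case/orP => [/N1|/N2] /flip/h_supp.
- apply/pred0P => y /=; apply/negP; rewrite E2 EX !inE => /andP[/andP[? ?] /andP[? ?]].
  by triangle.
- apply/pred0P => y /=; apply/negP; rewrite E1 EW !inE => /andP[/andP[? ?] /andP[? ?]].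
  by triangle.
- by apply/pred0P => y /=; apply/negP => /andP[/N1 ? /N2 ?]; triangle.
- by move=> x y /N1 /flip ? /N1 /flip ?; apply: (@nonadj_common _ _ c1).
- by move=> x y /N2 /flip ? /N2 /flip ?; apply: (@nonadj_common _ _ c2).
- move=> x w xX wW; apply/negP => xw.
  have : w \in B1 by rewrite -(XB x c2 xX c2B) inE xw N2 // inE wW orbT.
  by rewrite E1; move: wW; rewrite EW !inE => /andP[? ?] /andP[? ?]; triangle.
Qed.

(** The neighbours of [v] and the remaining vertices both form stable sets: an edge [x y] among the
    latter, with common neighbours of [v] and [x] and of [v] and [y], would give a 5-cycle. *)
Lemma bipartition v : v \in V -> (forall c0 c1 c2 c3 c4, ~~ pentagon c0 c1 c2 c3 c4) ->
  exists2 A : {set T}, A \subset V /\ #|V| <= 2 * #|A| &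
    {in A &, forall x y, ~~ h x y}.
Proof.
move=> vV noC.
pose L := [set x | h v x].
have LV : L \subset V by apply/subsetP => x; rewrite inE => /flip /h_supp.
have stL : {in L &, forall x y, ~~ h x y}.
  by move=> x y /[!inE] vx vy; apply/negP => xy; triangle.
have stR : {in V :\: L &, forall x y, ~~ h x y}.
  move=> x y /[!inE] /andP[nvx xV] /andP[nvy yV]; apply/negP => xy.
  have [E|nxv] := eqVneq v x; first by subst x; triangle.
  have [E|nyv] := eqVneq v y; first by subst y; triangle.
  have [a va xa] := diam2 vV xV nxv nvx.
  have [b vb yb] := diam2 vV yV nyv nvy.
  case/negP: (noC v a x y b); apply/and5P; split=> //; exact: flip.
have E : #|V| = #|L| + #|V :\: L|.
  by rewrite -(cardsID L V); congr (_ + _); rewrite (setIidPr LV).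
case: (leqP #|L| #|V :\: L|) => le; [exists (V :\: L)|exists L] => //.
  by rewrite subsetDl; split=> //; lia.
by split=> //; lia.
Qed.

End DominatingPentagons.

Lemma pairwise_zip (A B : eqType) (s : seq A) (t : seq B) : uniq s -> uniq t ->
  pairwise (fun p q => (p.1 != q.1) && (p.2 != q.2)) (zip s t).
Proof.
elim: s t => [|a s IHs] [|b t] //= /andP[na us] /andP[nb ut].
rewrite IHs // andbT; apply/allP => -[c d] /= cd; apply/andP; split.
  apply: contraNneq na => ->.
  by elim: s t cd {IHs us nb ut} => [|a' s IHs] [|b' t] //;
    rewrite !inE => /orP[/eqP[-> _]|/IHs->]; rewrite ?eqxx ?orbT.
apply: contraNneq nb => ->.
by elim: t s cd {IHs us na ut} => [|b' t IHt] [|a' s] //;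
  rewrite !inE => /orP[/eqP[_ ->]|/IHt->]; rewrite ?eqxx ?orbT.
Qed.

(** * Clique minors as lists of branch sets *)

Section CliqueMinors.
Variables (T : finType) (e : rel T).
Hypothesis e_sym : symmetric e.

Definition touch (B C : {set T}) : bool := [exists x in B, exists y in C, e x y].

Definition branch_set (V B : {set T}) : bool :=
  [&& B != set0, connected_in e B & B \subset V].

(** A list, unlike a family indexed by ['I_t], can be concatenated; [V] confines the model to an
    induced subgraph, as the inductions require. *)
Definition clique_model (V : {set T}) (s : seq {set T}) : bool :=
  all (branch_set V) s && pairwise (fun B C : {set T} => [disjoint B & C] && touch B C) s.

Lemma touchP (B C : {set T}) x y : x \in B -> y \in C -> e x y -> touch B C.
Proof. by move=> xB yC xy; apply/exists_inP; exists x => //; apply/exists_inP; exists y. Qed.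

Lemma touchC (B C : {set T}) : touch B C = touch C B.
Proof.
by apply/idP/idP => /exists_inP[x xB /exists_inP[y yC xy]];
  apply: (touchP yC xB); rewrite e_sym.
Qed.

Lemma branch_set1 (V : {set T}) x : x \in V -> branch_set V [set x].
Proof.
move=> xV; apply/and3P; split; rewrite ?sub1set //.
  by apply/set0Pn; exists x; rewrite set11.
by apply/forall_inP => a /set1P->; apply/forall_inP => b /set1P->; apply: connect0.
Qed.

Lemma branch_set2 (V : {set T}) x y : x \in V -> y \in V -> e x y -> branch_set V [set x; y].
Proof.
move=> xV yV xy; apply/and3P; split.
- by apply/set0Pn; exists x; rewrite set21.
- apply/forall_inP => a aB; apply/forall_inP => b bB.
  have [->|nab] := eqVneq a b; first exact: connect0.
  apply: connect1; apply/and3P; split=> //.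
  by case/set2P: aB nab => ->; case/set2P: bB => ->; rewrite ?eqxx // e_sym.
- by rewrite subUset !sub1set xV.
Qed.

Lemma clique_model_cat (V1 V2 V : {set T}) s1 s2 :
    V1 \subset V -> V2 \subset V -> clique_model V1 s1 -> clique_model V2 s2 ->
    (forall B C : {set T}, B \in s1 -> C \in s2 -> [disjoint B & C] && touch B C) ->
  clique_model V (s1 ++ s2).
Proof.
move=> V1V V2V /andP[a1 p1] /andP[a2 p2] d12.
rewrite /clique_model all_cat pairwise_cat p1 p2 !andbT.
have sub (U : {set T}) s : U \subset V -> all (branch_set U) s -> all (branch_set V) s.
  move=> UV; apply: sub_all => B /and3P[? ? BU]; apply/and3P; split=> //.
  exact: subset_trans UV.
rewrite (sub _ _ V1V a1) (sub _ _ V2V a2) /=.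
by apply/allrelP.
Qed.

Lemma clique_modelS (V1 V : {set T}) s : V1 \subset V -> clique_model V1 s -> clique_model V s.
Proof.
move=> V1V ms; rewrite -(cats0 s).
by apply: (clique_model_cat V1V (subxx V) ms).
Qed.

Lemma clique_model_hadwiger s : clique_model setT s -> size s <= hadwiger e.
Proof.
move=> /andP[/allP as_ /(pairwiseP set0) ps].
have wf (i : 'I_(size s)) : branch_set setT (nth set0 s i).
  by apply: as_; apply: mem_nth.
have pw (i j : 'I_(size s)) : i != j ->
    [disjoint nth set0 s i & nth set0 s j] && touch (nth set0 s i) (nth set0 s j).
  rewrite -val_eqE neq_ltn => /orP[] lt; last rewrite disjoint_sym touchC;
    by apply: ps => //; rewrite inE.
have dj (i j : 'I_(size s)) : i != j -> [disjoint nth set0 s i & nth set0 s j].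
  by case/pw/andP.
(* [hadwiger] ranges over orders up to [#|T|]; choosing a vertex in each of the disjoint branch sets
   gives this bound. *)
have szT : size s < #|T|.+1.
  have ne i : exists x, x \in nth set0 s (val (i : 'I_(size s))).
    by apply/set0Pn; case/and3P: (wf i).
  rewrite ltnS -[X in X <= _]card_ord.
  apply: (@leq_card _ _ (fun i => xchoose (ne i))) => i j Eij.
  apply/eqP/negPn/negP => /dj; rewrite disjoints_subset => /subsetP/(_ _ (xchooseP (ne i))).
  by rewrite inE Eij => /negP; apply; apply: (xchooseP (ne j)).
apply: (leq_bigmax_cond (Ordinal szT)).
apply/existsP; exists [ffun i : 'I_(size s) => nth set0 s i].
apply/and4P; split; apply/forallP => i.
- by rewrite ffunE; case/and3P: (wf i).
- by rewrite ffunE; case/and3P: (wf i).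
- by apply/forallP => j; rewrite !ffunE; apply/implyP => /dj.
- by apply/forallP => j; rewrite !ffunE; apply/implyP => /pw/andP[].
Qed.

(** The induction step: each pair spends at most two vertices for one branch set and, being
    dominating, touches every branch set found outside [S]. *)
Lemma dominating_pairs (V : {set T}) (ps : seq (T * T)) (S := [set x in unzip1 ps ++ unzip2 ps]) s :
    (forall p, p \in ps -> [/\ p.1 \in V, p.2 \in V & e p.1 p.2]) ->
    pairwise (fun p q => [disjoint [set p.1; p.2] & [set q.1; q.2]] &&
                         touch [set p.1; p.2] [set q.1; q.2]) ps ->
    (forall v p, v \in V -> v \notin S -> p \in ps -> e v p.1 || e v p.2) ->
    clique_model (V :\: S) s -> #|V :\: S| <= 2 * size s ->
  exists2 s', clique_model V s' & #|V| <= 2 * size s'.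
Proof.
move=> psP psW psD ms szs.
pose s0 := [seq [set p.1; p.2] | p <- ps].
have inS p : p \in ps -> p.1 \in S /\ p.2 \in S.
  by move=> pps; rewrite !inE !mem_cat !map_f ?orbT.
exists (s ++ s0); last first.
  have SE : #|S| <= 2 * size ps.
    rewrite cardsE (leq_trans (card_size _)) // size_cat !size_map; lia.
  have : #|V| <= #|S| + #|V :\: S|.
    by rewrite -(cardsID S V) leq_add2r subset_leq_card // subsetIr.
  rewrite size_cat size_map; lia.
apply: (@clique_model_cat (V :\: S) V) => //; first exact: subsetDl.
  apply/andP; split; last by rewrite pairwise_map.
  by apply/allP => _ /mapP[p /psP[? ? ?] ->]; apply: branch_set2.
move=> B _ Bs /mapP[p pps ->]; have [p1S p2S] := inS p pps.
have /andP[/allP/(_ B Bs)/and3P[/set0Pn[v vB] _ BV] _] := ms.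
have /setDP[vV vS] := subsetP BV v vB.
apply/andP; split.
  rewrite -setI_eq0; apply/eqP/setP => u; rewrite !inE; apply/negP => /andP[uB].
  have /setDP[_ /negP uS] := subsetP BV u uB.
  by case/orP=> /eqP E; apply: uS; rewrite E.
by case/orP: (psD v p vV vS pps); apply: touchP => //; rewrite ?set21 ?set22.
Qed.

End CliqueMinors.

(** * The complement graph and clique minors on half of the vertices *)

Section IndependenceNumberTwo.
Variables (T : finType) (e : rel T).
Hypothesis e_simple : simple_graph e.
Hypothesis alpha2 : alpha e <= 2.
Hypothesis noW5 : W5_free e.

Let e_sym : symmetric e. Proof. by case: e_simple. Qed.
Let e_irr : irreflexive e. Proof. by case: e_simple. Qed.

Definition nonadj (x y : T) : bool := (x != y) && ~~ e x y.

Definition nonadj_in (V : {set T}) (x y : T) : bool :=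
  [&& x \in V, y \in V & nonadj x y].

Lemma nonadj_sym : symmetric nonadj.
Proof. by move=> x y; rewrite /nonadj eq_sym e_sym. Qed.

Lemma nonadj_in_sym V : symmetric (nonadj_in V).
Proof. by move=> x y; rewrite /nonadj_in nonadj_sym andbCA. Qed.

Lemma nonadj_triangle x y z : nonadj x y -> nonadj y z -> nonadj x z -> False.
Proof.
move=> /andP[nxy exy] /andP[nyz eyz] /andP[nxz exz].
have : #|[set x; y; z]| <= alpha e.
  apply: leq_bigmax_cond; apply/forall_inP => a aS; apply/forall_inP => b bS.
  by move: aS bS; rewrite !inE => /orP[/orP[]|] /eqP-> /orP[/orP[]|] /eqP->;
    rewrite ?e_irr // e_sym.
move=> /leq_trans/(_ alpha2).
by rewrite -setUA cardsU1 cards2 !inE negb_or nxy nxz nyz.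
Qed.

Lemma nonadj_in_triangle V x y z :
  nonadj_in V x y -> nonadj_in V y z -> nonadj_in V x z -> False.
Proof. by move=> /and3P[_ _ a] /and3P[_ _ b] /and3P[_ _ c]; apply: (nonadj_triangle a b c). Qed.

(** A 5-cycle of [H] is induced for lack of triangles, so its complement is an induced 5-cycle of
    the graph; a vertex adjacent in [H] to none of it would be the hub of an induced [W_5]. *)
Lemma pentagon_wheel V c0 c1 c2 c3 c4 v :
    pentagon (nonadj_in V) c0 c1 c2 c3 c4 -> v \in V ->
  [|| nonadj_in V v c0, nonadj_in V v c1, nonadj_in V v c2, nonadj_in V v c3 |
      nonadj_in V v c4].
Proof.
move=> /and5P[/and3P[V0 V1 h01] /and3P[_ V2 h12] /and3P[_ V3 h23]
  /and3P[_ V4 h34] /and3P[_ _ h40]] vV.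
rewrite /nonadj_in vV V0 V1 V2 V3 V4 /=; apply/negPn/negP; rewrite !negb_or.
move=> /and5P[nv0 nv1 nv2 nv3 nv4].
have edge a b : nonadj a b ->
    (e a b = false) * (e b a = false) * ((a == b) = false) * ((b == a) = false).
  by move=> /andP[/negPf ab /negPf eab]; rewrite (e_sym b) (eq_sym b) ab eab.
have adj a b : ~~ nonadj a b -> a != b ->
    (e a b = true) * (e b a = true) * ((a == b) = false) * ((b == a) = false).
  rewrite /nonadj (e_sym b) (eq_sym b) => nab /negPf ab.
  by move: nab; rewrite ab /= negbK.
(* The neighbour [b] of [a] in [H] shows that [v] is not [a], hence that [v] is off the cycle. *)
have spoke a b : nonadj a b -> ~~ nonadj v a -> ~~ nonadj v b ->
    (e v a = true) * (e a v = true) * ((v == a) = false) * ((a == v) = false).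
  by move=> ab nva nvb; apply: adj => //; apply: contraNneq nvb => ->.
have chord a b c d f : nonadj a b -> nonadj b c -> nonadj c d -> nonadj d f -> nonadj f a ->
    (e a c = true) * (e c a = true) * ((a == c) = false) * ((c == a) = false).
  move=> ab bc cd df fa; apply: adj.
    by apply/negP => ac; apply: (nonadj_triangle ab bc ac).
  apply/eqP => E; subst c; apply: (nonadj_triangle cd df).
  by rewrite nonadj_sym.
(* Steps of two along the cycle of [H] give the rim of the wheel. *)
pose w (i : 'I_6) := nth v [:: c0; c2; c4; c1; c3; v] i.
have facts := (e_irr, eqxx, edge _ _ h01, edge _ _ h12, edge _ _ h23, edge _ _ h34, edge _ _ h40,
  chord _ _ _ _ _ h01 h12 h23 h34 h40, chord _ _ _ _ _ h12 h23 h34 h40 h01,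
  chord _ _ _ _ _ h23 h34 h40 h01 h12, chord _ _ _ _ _ h34 h40 h01 h12 h23,
  chord _ _ _ _ _ h40 h01 h12 h23 h34,
  spoke _ _ h01 nv0 nv1, spoke _ _ h12 nv1 nv2, spoke _ _ h23 nv2 nv3,
  spoke _ _ h34 nv3 nv4, spoke _ _ h40 nv4 nv0).
apply: noW5; exists w; split.
  move=> i j /eqP; rewrite /w nth_uniq //= => [/eqP/val_inj //|].
  by rewrite !inE !facts.
case=> [[|[|[|[|[|[|//]]]]]] ?] [[|[|[|[|[|[|//]]]]]] ?];
  by rewrite /w /w5_rel -val_eqE /= !facts.
Qed.

Lemma half_clique_model V : exists2 s, clique_model e V s & #|V| <= 2 * size s.
Proof.
have [n] := ubnP #|V|; elim: n V => // n IHn V /ltnSE leVn.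
have shrink x (U : {set T}) : x \in V -> x \in U ->
    exists2 s, clique_model e (V :\: U) s & #|V :\: U| <= 2 * size s.
  move=> xV xU; apply: IHn; apply: leq_trans leVn; apply: proper_card.
  by apply/properP; split; [apply: subsetDl|exists x => //; rewrite inE xU].
(* First case: some edge [x y] of the graph dominates it, and serves as a branch set. *)
have [/exists_inP[x xV /exists_inP[y yV /andP[exy dom]]]|nodom] := boolP
  [exists x in V, exists y in V, e x y && [forall v in V, ~~ (nonadj v x && nonadj v y)]].
  have [|s ms szs] := shrink x [set v in [:: x] ++ [:: y]] xV; first by rewrite !inE eqxx.
  apply: (@dominating_pairs _ _ e_sym V [:: (x, y)] s) => // [p|v p vV vS].
    by rewrite inE => /eqP->.
  rewrite inE => /eqP-> /=; move/forall_inP/(_ v vV): dom.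
  by move: vS; rewrite !inE negb_or /nonadj => /andP[-> ->] /=; rewrite -negb_or negbK.
pose h := nonadj_in V.
have hsym : symmetric h := nonadj_in_sym V.
have hsupp x y : h x y -> x \in V by case/and3P.
have htri := @nonadj_in_triangle V.
have hdom := @pentagon_wheel V.
(* The edge [x y] of the graph does not dominate; a vertex missing both ends is a common neighbour
   in [H]. *)
have hdiam x y : x \in V -> y \in V -> x != y -> ~~ h x y -> exists2 z, h x z & h y z.
  move=> xV yV nxy nhxy; have exy : e x y.
    by move: nhxy; rewrite /h /nonadj_in xV yV /nonadj nxy /= negbK.
  move/exists_inPn/(_ x xV)/exists_inPn/(_ y yV): nodom; rewrite exy /=.
  case/forall_inPn=> z zV; rewrite negbK => /andP[zx zy].
  by exists z; apply/and3P; split=> //; rewrite nonadj_sym.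
have [->|[v vV]] := set_0Vmem V; first by exists [::] => //; rewrite cards0.
have adjE x y : x \in V -> y \in V -> ~~ h x y -> x != y -> e x y.
  by move=> xV yV; rewrite /h /nonadj_in /nonadj xV yV /= => /nandP[/negPf->|/negPn].
case: (boolP [exists c : T * T * T * T * T,
    let: (c0, c1, c2, c3, c4) := c in pentagon h c0 c1 c2 c3 c4]); last first.
  move=> /existsPn noC.
  have [A [AV szA] stA] := bipartition hsym hsupp htri hdiam vV
    (fun c0 c1 c2 c3 c4 => noC (c0, c1, c2, c3, c4)).
  exists [seq [set x] | x <- enum A]; last by rewrite size_map -cardE.
  apply/andP; split.
    apply/allP => _ /mapP[x xA ->]; apply: branch_set1.
    by rewrite mem_enum in xA; apply: subsetP AV x xA.
  rewrite pairwise_map.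
  have := enum_uniq A; rewrite uniq_pairwise; apply: (@sub_in_pairwise _ (mem A)).
    2: by apply/allP => x; rewrite mem_enum.
  move=> x y xA yA /= nxy.
  have exy : e x y by apply: adjE; rewrite ?(subsetP AV) ?stA.
  rewrite disjoints1 inE nxy /=.
  by apply: (@touchP _ _ _ _ x y); rewrite ?set11.
case/existsP => [[[[[d0 d1] d2] d3] d4]] D.
have [B1 [B2 [X [W [UV B20 [lX lW] [dBX dBW dd] [st1 st2 stXW cB1 cB2]]]]]] :=
  dominating_classes hsym hsupp htri hdom hdiam D.
have [B1V B2V XV WV] : [/\ B1 \subset V, B2 \subset V, X \subset V & W \subset V].
  by move: UV; rewrite !subUset -!andbA => /and4P.
(* Truncation makes the lists equally long, so that every vertex of [B2] and [B1] is paired; the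
   domination argument needs them all in [S]. *)
pose ps1 := zip (enum B2) (take #|B2| (enum X)).
pose ps2 := zip (enum B1) (take #|B1| (enum W)).
have sz1 : size (enum B2) = size (take #|B2| (enum X)) by rewrite size_takel -?cardE.
have sz2 : size (enum B1) = size (take #|B1| (enum W)) by rewrite size_takel -?cardE.
have ps1P p : p \in ps1 -> p.1 \in B2 /\ p.2 \in X.
  move=> pp; rewrite -mem_enum -[p.2 \in X]mem_enum; split.
    by rewrite -(unzip1_zip (eq_leq sz1)); apply: map_f.
  apply: (@mem_take #|B2|).
  by rewrite -(unzip2_zip (eq_leq (esym sz1))); apply: map_f.
have ps2P p : p \in ps2 -> p.1 \in B1 /\ p.2 \in W.
  move=> pp; rewrite -mem_enum -[p.2 \in W]mem_enum; split.
    by rewrite -(unzip1_zip (eq_leq sz2)); apply: map_f.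
  apply: (@mem_take #|B1|).
  by rewrite -(unzip2_zip (eq_leq (esym sz2))); apply: map_f.
pose S := [set x in unzip1 (ps1 ++ ps2) ++ unzip2 (ps1 ++ ps2)].
have U1 : unzip1 (ps1 ++ ps2) = enum B2 ++ enum B1.
  by rewrite /unzip1 map_cat -!/(unzip1 _) !unzip1_zip ?sz1 ?sz2.
have B2S : B2 \subset S.
  by apply/subsetP => x xB; rewrite inE U1 !mem_cat mem_enum xB.
have B1S : B1 \subset S.
  by apply/subsetP => x xB; rewrite inE U1 !mem_cat !mem_enum xB orbT.
(* As [B2] is nonempty, removing [S] makes [V] smaller. *)
have [b bB] := set0Pn _ B20.
have [s ms szs] := shrink b S (subsetP B2V b bB) (subsetP B2S b bB).
have neq (A B : {set T}) x y : [disjoint A & B] -> x \in A -> y \in B -> x != y.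
  by move=> dAB xA yB; apply: contraTneq yB => <-; rewrite (disjointFr dAB xA).
have disj4 (x y x' y' : T) : x != x' -> x != y' -> y != x' -> y != y' ->
    [disjoint [set x; y] & [set x'; y']].
  move=> n1 n2 n3 n4; apply/pred0P => a /=; rewrite !inE.
  apply/negP => /andP[] /orP[]/eqP-> /orP[]; exact/negP.
have inU (A B : {set T}) u : (u \in A) || (u \in B) -> u \in A :|: B by rewrite inE.
apply: (@dominating_pairs _ _ e_sym V (ps1 ++ ps2) s) => //.
- move=> p; rewrite mem_cat => /orP[/ps1P|/ps2P] [p1 p2].
    have [p1V p2V] := (subsetP B2V _ p1, subsetP XV _ p2); split=> //.
    apply: adjE => //; last exact: neq dBX p1 p2.
    by apply: st1; apply: inU; rewrite ?p1 ?p2 ?orbT.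
  have [p1V p2V] := (subsetP B1V _ p1, subsetP WV _ p2); split=> //.
  apply: adjE => //; last exact: neq dBW p1 p2.
  by apply: st2; apply: inU; rewrite ?p1 ?p2 ?orbT.
(* Pairs of different kinds touch through [X] and [W]; pairs of the same kind touch through their
   first components, which lie in one clique. *)
- rewrite pairwise_cat; apply/and3P; split.
  + apply/allrelP => p q /ps1P[p1 p2] /ps2P[q1 q2]; apply/andP; split.
      by apply: disj4; apply: (neq _ _ _ _ dd); apply: inU; rewrite ?p1 ?p2 ?q1 ?q2 ?orbT.
    apply: (@touchP _ _ _ _ p.2 q.2); rewrite ?set22 //.
    apply: adjE; [exact: (subsetP XV)|exact: (subsetP WV)|exact: stXW|].
    by apply: (neq _ _ _ _ dd); apply: inU; rewrite ?p2 ?q2 ?orbT.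
  + have := pairwise_zip (enum_uniq B2) (take_uniq #|B2| (enum_uniq X)).
    apply: (@sub_in_pairwise _ (mem ps1)); last exact/allP.
    move=> p q /ps1P[p1 p2] /ps1P[q1 q2] /andP[n1 n2]; apply/andP; split.
      apply: disj4 => //; first exact: (neq _ _ _ _ dBX).
      by rewrite eq_sym; exact: (neq _ _ _ _ dBX).
    apply: (@touchP _ _ _ _ p.1 q.1); rewrite ?set21 //.
    apply: adjE; rewrite ?(subsetP B2V) //.
    by apply: st1; apply: inU; rewrite ?p1 ?q1.
  + have := pairwise_zip (enum_uniq B1) (take_uniq #|B1| (enum_uniq W)).
    apply: (@sub_in_pairwise _ (mem ps2)); last exact/allP.
    move=> p q /ps2P[p1 p2] /ps2P[q1 q2] /andP[n1 n2]; apply/andP; split.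
      apply: disj4 => //; first exact: (neq _ _ _ _ dBW).
      by rewrite eq_sym; exact: (neq _ _ _ _ dBW).
    apply: (@touchP _ _ _ _ p.1 q.1); rewrite ?set21 //.
    apply: adjE; rewrite ?(subsetP B1V) //.
    by apply: st2; apply: inU; rewrite ?p1 ?q1.
(* A vertex missing both ends of a pair is their common neighbour in [H], so it lies in [B1] or [B2]
   and hence in [S]. *)
- move=> u p uV uS pps; apply/negPn/negP; rewrite negb_or => /andP[n1 n2].
  have [p1S p2S] : p.1 \in S /\ p.2 \in S.
    by rewrite !inE !mem_cat !map_f ?orbT.
  have hv q : q \in V -> q \in S -> ~~ e u q -> h q u.
    move=> qV qS nvq; rewrite hsym; apply/and3P; split=> //; apply/andP; split=> //.
    by apply: contraNneq uS => ->.
  move: pps; rewrite mem_cat => /orP[/ps1P|/ps2P] [p1 p2].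
    have [p1V p2V] := (subsetP B2V _ p1, subsetP XV _ p2).
    have : u \in common h p.2 p.1 by rewrite inE !hv.
    by rewrite cB1 // => /(subsetP B1S); apply/negP.
  have [p1V p2V] := (subsetP B1V _ p1, subsetP WV _ p2).
  have : u \in common h p.1 p.2 by rewrite inE !hv.
  by rewrite cB2 // => /(subsetP B2S); apply/negP.
Qed.


(** * Matchings of the complement and Gallai's argument *)

Definition matching (V : {set T}) (M : {set {set T}}) : bool :=
  trivIset M && [forall F in M, exists x in V, exists y in V,
                   nonadj x y && (F == [set x; y])].

Lemma matchingP (V : {set T}) M F : matching V M -> F \in M ->
  exists x y, [/\ x \in V, y \in V, nonadj x y & F = [set x; y]].
Proof.
move=> /andP[_ /forall_inP mM] /mM/exists_inP[x xV /exists_inP[y yV /andP[xy /eqP ->]]].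
by exists x, y.
Qed.

Lemma matching_sub (V1 V2 : {set T}) (M1 M2 : {set {set T}}) :
  V1 \subset V2 -> M1 \subset M2 -> matching V1 M2 -> matching V2 M1.
Proof.
move=> sV sM mM; apply/andP; split; first by apply: trivIsetS sM _; case/andP: mM.
apply/forall_inP => F /(subsetP sM)/(matchingP mM)[x [y [xV yV xy ->]]].
apply/exists_inP; exists x; first exact: subsetP xV.
by apply/exists_inP; exists y; rewrite ?xy ?eqxx //; apply: subsetP yV.
Qed.

Lemma matching0 (V : {set T}) : matching V set0.
Proof.
apply/andP; split; first by apply/trivIsetP => A B; rewrite inE.
by apply/forall_inP => F; rewrite inE.
Qed.

Lemma matching_set0 (V : {set T}) M : matching V M -> set0 \notin M.
Proof.
move=> mM; apply/negP => /(matchingP mM)[x [y [_ _ _ /setP/(_ x)]]].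
by rewrite !inE eqxx.
Qed.

Lemma card_cover_matching (V : {set T}) M : matching V M -> #|cover M| = 2 * #|M|.
Proof.
move=> mM; have /andP[/eqP <- _] := mM.
rewrite mulnC -sum_nat_const; apply: eq_bigr => F /(matchingP mM)[x [y [_ _ /andP[nxy _] ->]]].
by rewrite cards2 nxy.
Qed.

Lemma cover_matching (V : {set T}) M : matching V M -> cover M \subset V.
Proof.
move=> mM; apply/bigcupsP => F /(matchingP mM)[x [y [xV yV _ ->]]].
by rewrite subUset !sub1set xV.
Qed.

Lemma matchingU1 (V : {set T}) M x y :
    matching V M -> x \in V -> y \in V -> nonadj x y ->
    x \notin cover M -> y \notin cover M ->
  matching V ([set x; y] |: M) /\ #|[set x; y] |: M| = #|M|.+1.
Proof.
move=> mM xV yV xy nx ny; have /andP[tM /forall_inP eM] := mM.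
have [F FM|t nM] := trivIsetU1 (A := [set x; y]) _ tM (matching_set0 mM).
  rewrite -setI_eq0; apply/eqP/setP => u; rewrite !inE; apply/negP => /andP[+ uF].
  have uM : u \in cover M by apply/bigcupP; exists F.
  by case/orP=> /eqP E; move: nx ny; rewrite -E uM.
split; last by rewrite cardsU1 nM.
apply/andP; split=> //; apply/forall_inP => F /setU1P[->|/eM//].
by apply/exists_inP; exists x => //; apply/exists_inP; exists y; rewrite ?xy ?eqxx.
Qed.

Definition max_matching (V : {set T}) (M : {set {set T}}) : bool :=
  matching V M && [forall M', matching V M' ==> (#|M'| <= #|M|)].

Lemma max_matchingP (V : {set T}) M :
  reflect (matching V M /\ forall M', matching V M' -> #|M'| <= #|M|) (max_matching V M).
Proof.
by apply: (iffP andP) => -[mM /forall_inP].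
Qed.

Lemma max_matching_exists (V : {set T}) : exists M, max_matching V M.
Proof.
have [M mM maxM] := @arg_maxnP _ set0 (matching V) (fun M => #|M|) (matching0 V).
by exists M; apply/max_matchingP.
Qed.

Lemma card_max_matching (V : {set T}) M N : max_matching V M -> max_matching V N -> #|M| = #|N|.
Proof.
move=> /max_matchingP[mM maxM] /max_matchingP[mN maxN].
by apply/eqP; rewrite eqn_leq maxM ?maxN.
Qed.

Definition inseparable (V : {set T}) (u v : T) : bool :=
  [forall M, max_matching V M ==> (u \in cover M) || (v \in cover M)].

Lemma inseparableP (V : {set T}) u v M :
  inseparable V u v -> max_matching V M -> u \notin cover M -> v \in cover M.
Proof. by move=> /forall_inP uv /uv /orP[->|]. Qed.

Lemma inseparable_sym (V : {set T}) u v : inseparable V u v = inseparable V v u.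
Proof. by apply: eq_forallb => M; rewrite orbC. Qed.

(** If a maximum matching missed both, the edge [u v] of [H] would enlarge it. *)
Lemma inseparable_nonadj (V : {set T}) u v : u \in V -> v \in V -> nonadj u v -> inseparable V u v.
Proof.
move=> uV vV uv; apply/forall_inP => M /max_matchingP[mM maxM].
apply/negPn/negP; rewrite negb_or => /andP[nu nv].
have [/maxM] := matchingU1 mM uV vV uv nu nv.
by move=> le E; rewrite E ltnn in le.
Qed.

(* Trade the [N]-edge at the [M]-partner of [x] for the [M]-edge at [x]. *)
Lemma matching_exchange (V : {set T}) M N x t :
    max_matching V M -> max_matching V N -> x \in cover M -> x \notin cover N ->
    t \notin cover N -> x != t ->
  exists N', [/\ max_matching V N', t \notin cover N' & #|M :&: N| < #|M :&: N'|].
Proof.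
move=> /max_matchingP[mM maxM] /max_matchingP[mN maxN] /bigcupP[E EM xE] nxN ntN nxt.
have [y [yV xy defE]] : exists y, [/\ y \in V, nonadj x y & E = [set x; y]].
  have [a [b [aV bV ab defE]]] := matchingP mM EM.
  move: xE; rewrite defE => /set2P[->|->]; first by exists b.
  by exists a; rewrite nonadj_sym setUC.
have xV : x \in V.
  by apply: (subsetP (cover_matching mM)); apply/bigcupP; exists E.
have yN : y \in cover N.
  apply/negPn/negP => nyN; have [/maxN] := matchingU1 mN xV yV xy nxN nyN.
  by move=> le Ec; rewrite Ec ltnn in le.
have [F FN yF] := bigcupP yN.
have sN : N :\ F \subset N by apply: subsetDl.
have mN1 := matching_sub (subxx V) sN mN.
have nin u : u \notin cover N -> u \notin cover (N :\ F).
  by apply: contra => /bigcupP[G /(subsetP sN) GN uG]; apply/bigcupP; exists G.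
have nyN1 : y \notin cover (N :\ F).
  apply/negP => /bigcupP[G /setD1P[nGF GN] yG].
  have /andP[/trivIsetP/(_ G F GN FN nGF) dGF _] := mN.
  by rewrite (disjointFr dGF yG) in yF.
have [mN' cN'] := matchingU1 mN1 xV yV xy (nin x nxN) nyN1.
exists ([set x; y] |: N :\ F).
have cN : #|[set x; y] |: N :\ F| = #|N| by rewrite cN' (cardsD1 F N) FN.
split.
- by apply/max_matchingP; rewrite cN.
- apply/negP => /bigcupP[G /setU1P[->|GN] tG].
    case/set2P: tG nxt ntN => ->; first by rewrite eqxx.
    by rewrite yN.
  by case/negP: (nin t ntN); apply/bigcupP; exists G.
(* The intersection with [M] gains [E] and loses nothing: if [F] were in [M] it would equal [E], and
   [N] would cover [x]. *)
- have EN : E \notin N.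
    by apply: contra nxN => EN; apply/bigcupP; exists E.
  have FM : F \notin M.
    apply: contra nxN => FM; apply/bigcupP; exists F => //.
    have yE : y \in E by rewrite defE set22.
    have [<- //|nEF] := eqVneq E F.
    have /andP[/trivIsetP/(_ E F EM FM nEF) dEF _] := mM.
    by rewrite (disjointFr dEF yE) in yF.
  apply: proper_card; apply/properP; split.
    apply/subsetP => G; rewrite !inE => /andP[GM ->]; rewrite GM andbT /=.
    by apply/orP; right; apply: contraNneq FM => <-.
  by exists E; rewrite !inE EM ?negb_and ?EN ?orbT // defE eqxx.
Qed.

(** Suppose a maximum matching [M] misses [u] and [v], and let [N] share the most edges with [M]
    among the maximum matchings missing [t]. Then [N] covers [u] and [v]; as both covers have the
    same size, [M] covers two vertices missed by [N], one of them some [x] other than [t]. An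
    exchange at [x] contradicts the choice of [N]. *)
Lemma inseparable_trans (V : {set T}) u t v : u != v ->
    (exists2 N, max_matching V N & t \notin cover N) ->
    inseparable V u t -> inseparable V t v -> inseparable V u v.
Proof.
move=> nuv [N0 N0max tN0] ut tv; apply/forall_inP => M Mmax.
apply/negPn/negP; rewrite negb_or => /andP[uM vM].
pose P N := max_matching V N && (t \notin cover N).
have P0 : P N0 by rewrite /P N0max.
have [N /andP[Nmax tN] Nbest] := @arg_maxnP _ N0 P (fun N => #|M :&: N|) P0.
have uN : u \in cover N by apply: (inseparableP _ Nmax tN); rewrite inseparable_sym.
have vN : v \in cover N by apply: (inseparableP tv Nmax tN).
have tM : t \in cover M by apply: (inseparableP ut Mmax uM).
have [x] : exists x, x \in (cover M :\: cover N) :\ t.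
  apply/set0Pn; rewrite -card_gt0.
  have cMN : #|cover M| = #|cover N|.
    have [[mM _] [mN _]] := (max_matchingP _ _ Mmax, max_matchingP _ _ Nmax).
    by rewrite (card_cover_matching mM) (card_cover_matching mN) (card_max_matching Mmax Nmax).
  have le2 : 2 <= #|cover N :\: cover M|.
    rewrite -[2]/(true.+1) -nuv -cards2 subset_leq_card //.
    by rewrite subUset !sub1set !inE uM vM uN vN.
  have := cardsID (cover N) (cover M); have := cardsID (cover M) (cover N).
  have := cardsD1 t (cover M :\: cover N); rewrite setIC; move: le2 cMN; clear; lia.
rewrite !inE => /and3P[nxt xN xM].
have [N' [N'max tN']] := matching_exchange Mmax Nmax xM xN tN nxt.
have /Nbest : P N' by rewrite /P N'max.
by rewrite /= leqNgt => /negPf->.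
Qed.

Lemma clique_model_matching (V : {set T}) : exists s M,
  [/\ clique_model e V s, matching V M & #|V| <= size s + #|M|].
Proof.
have [n] := ubnP #|V|; elim: n V => // n IHn V /ltnSE leVn.
have IH (U : {set T}) : U \proper V -> exists s M,
    [/\ clique_model e U s, matching U M & #|U| <= size s + #|M|].
  by move=> UV; apply: IHn; apply: leq_trans leVn; apply: proper_card.
have [Mx Mxmax] := max_matching_exists V; have /max_matchingP[mMx maxMx] := Mxmax.
(* Deleting a vertex covered by all maximum matchings lowers the matching number, so the model found
   in [V :\ v] is large enough for [V]. *)
have [/exists_inP[v vV /forall_inP ess]|] := boolP
    [exists v in V, forall M, max_matching V M ==> (v \in cover M)].
  have [|s [M [ms mM le]]] := IH (V :\ v); first exact: properD1.
  have mMV : matching V M := matching_sub (subD1set V v) (subxx M) mM.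
  exists s, Mx; split=> //; first exact: clique_modelS (subD1set V v) ms.
  suff lt : #|M| < #|Mx| by rewrite (cardsD1 v V) vV; lia.
  rewrite ltn_neqAle maxMx // andbT; apply/eqP => E.
  have /ess : max_matching V M by apply/max_matchingP; rewrite E.
  by move/(subsetP (cover_matching mM)); rewrite !inE eqxx.
move=> /exists_inPn miss.
have {}miss t : t \in V -> exists2 N, max_matching V N & t \notin cover N.
  by move/miss/forall_inPn.
have [/exists_inP[u uV /exists_inP[v vV /andP[nuv sep]]]|] := boolP
    [exists u in V, exists v in V, (u != v) && ~~ inseparable V u v].
  (* Some maximum matching misses [u], so [inseparable V u u] fails and [u] is added to its class
     explicitly. *)
  pose A := [set x in V | (x == u) || inseparable V u x].
  have AV : A \subset V by apply/subsetP => x /[!inE] /andP[].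
  have uA : u \in A by rewrite inE uV eqxx.
  have vA : v \notin A by rewrite inE vV (eq_sym v) negb_or nuv sep.
  have [|sA [MA [msA mMA leA]]] := IH A.
    by apply/properP; split=> //; exists v.
  have [|sB [MB [msB mMB leB]]] := IH (V :\: A).
    by apply/properP; split; [apply: subsetDl|exists u; rewrite // inE uA].
  (* A missing edge would make its ends inseparable and, by transitivity, put [y] in [A]. Hence the
     graph is a join, and the models of the two sides concatenate. *)
  have adjAB x y : x \in A -> y \in V :\: A -> e x y.
    move=> xA /setDP[yV nyA]; apply/negPn/negP => nxy.
    have neq : x != y by apply: contraNneq nyA => <-.
    have xV := subsetP AV x xA.
    have ixy : inseparable V x y by apply: inseparable_nonadj; rewrite // /nonadj neq.
    case/negP: nyA; rewrite inE yV /=; move: xA; rewrite inE xV /= => /orP[/eqP <-|iux].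
      by rewrite ixy orbT.
    have [//|nyu] := eqVneq y u.
    by rewrite (inseparable_trans _ (miss x xV) iux ixy) // eq_sym.
  have sub1 := subsetDl V A.
  have mA := matching_sub AV (subxx MA) mMA.
  have mB := matching_sub sub1 (subxx MB) mMB.
  have dis : [disjoint A & V :\: A].
    by rewrite -setI_eq0; apply/eqP/setP => x; rewrite !inE; case: ((x \in V) && _).
  have dcov : [disjoint cover MA & cover MB].
    exact: disjointW (cover_matching mMA) (cover_matching mMB) dis.
  have mAB : matching V (MA :|: MB).
    have /andP[tA /forall_inP eA] := mA; have /andP[tB /forall_inP eB] := mB.
    apply/andP; split; first exact: trivIsetU.
    by apply/forall_inP => F /setUP[/eA|/eB].
  have cAB : #|MA :|: MB| = #|MA| + #|MB|.
    (* The covers are disjoint and twice as large as the matchings. *)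
    apply: double_inj; rewrite doubleD -!mul2n.
    rewrite -(card_cover_matching mAB) -(card_cover_matching mA) -(card_cover_matching mB).
    by rewrite /cover bigcup_setU; apply/eqP; have [_ ->] := leq_card_setU (cover MA) (cover MB).
  exists (sA ++ sB), (MA :|: MB); split=> //.
    apply: (clique_model_cat AV sub1) => // B C BsA CsB.
    have /andP[/allP/(_ _ BsA)/and3P[/set0Pn[x xB] _ BA] _] := msA.
    have /andP[/allP/(_ _ CsB)/and3P[/set0Pn[y yC] _ CB] _] := msB.
    rewrite (disjointW BA CB dis) (touchP xB yC) // adjAB //; first exact: subsetP xB.
    exact: subsetP yC.
  rewrite cAB size_cat -(cardsID A V) (setIidPr AV); move: leA leB; clear; lia.
move=> /exists_inPn allsep.
have [s ms le] := half_clique_model V.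
exists s, Mx; split=> //.
(* Two missed vertices would not be inseparable. Hence [#|V| <= 2 * #|Mx| + 1]; adding
   [#|V| <= 2 * size s] and halving gives the claim. *)
have le1 : #|V :\: cover Mx| <= 1.
  rewrite leqNgt; apply/negP => /card_gt1P[x [y [/setDP[xV nx] /setDP[yV ny] nxy]]].
  move/(_ x xV)/exists_inPn/(_ y yV): allsep; rewrite nxy /= negbK => ixy.
  by case/negP: ny; apply: inseparableP ixy Mxmax nx.
have := cardsID (cover Mx) V; rewrite (setIidPr (cover_matching mMx)) (card_cover_matching mMx).
move: le le1; clear; lia.
Qed.

(** The edges of [M] and the uncovered vertices taken singly are the colour classes, at most
    [#|M| + (#|T| - 2 * #|M|)] in number. *)
Lemma chi_matching M : matching setT M -> chi e + #|M| <= #|T|.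
Proof.
move=> mM; have /andP[tM _] := mM.
pose g x := if x \in cover M then pblock M x else [set x].
have gx x : x \in g x by rewrite /g; case: ifP; rewrite ?mem_pblock ?set11.
pose G := g @: setT.
have gG x : g x \in G by apply: imset_f.
have col : colorable e #|G|.
  apply/existsP; exists [ffun x => enum_rank_in (gG x) (g x)].
  apply/forallP => x; apply/forallP => y; apply/implyP => /andP[nxy exy].
  rewrite !ffunE; apply/negP => /eqP/(congr1 enum_val); rewrite !enum_rankK_in // => Eg.
  have := gx y; rewrite -Eg /g; case: ifP => [xM yx|_]; last by rewrite inE eq_sym (negPf nxy).
  have := pblock_mem xM => /(matchingP mM)[a [b [_ _ /andP[_ /negP nab] E]]].
  have xp : x \in pblock M x by rewrite mem_pblock.
  move: xp yx nxy exy; rewrite E !inE => /orP[]/eqP-> /orP[]/eqP->; rewrite ?eqxx //.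
  by rewrite e_sym.
have leG : #|G| <= #|M| + #|~: cover M|.
  have sub : G \subset M :|: [set [set x] | x in ~: cover M].
    apply/subsetP => _ /imsetP[x _ ->]; rewrite /g inE; case: ifP => [/pblock_mem->//|xM].
    by rewrite imset_f ?orbT // inE xM.
  apply: leq_trans (subset_leq_card sub) _; apply: leq_trans (leq_card_setU _ _).1 _.
  by rewrite leq_add2l leq_imset_card.
have : chi e <= #|G| by rewrite /chi; case: ex_minnP => k _; apply.
have := cardsC (cover M); rewrite (card_cover_matching mM); move: leG; clear; lia.
Qed.

End IndependenceNumberTwo.

Theorem theorem1p5 (T : finType) (e : rel T) :
  simple_graph e -> alpha e <= 2 -> W5_free e -> chi e <= hadwiger e.
Proof.
move=> e_simple alpha2 noW5; have [e_sym _] := e_simple.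
have [s [M [ms mM le]]] := clique_model_matching e_simple alpha2 noW5 setT.
apply: leq_trans (clique_model_hadwiger e_sym ms).
(* [#|T|] lies between [chi e + #|M|] and [size s + #|M|]. *)
rewrite cardsT in le; rewrite -(leq_add2r #|M|); apply: leq_trans le.
exact: chi_matching.
Qed.
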